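(* Let $C = \{X \in \mathbf{S}^3_+ : X_{11} = X_{22} + X_{33}\}$, where $\mathbf{S}^3_+$ is the cone of real symmetric $3\times 3$ positive semidefinite matrices. Then there is no second-order cone representable set $T$ with $C \subseteq T \subseteq \mathbf{S}^3_+$. In particular, $C$ does not have a second-order cone lift (of any finite size).
   Context: $\mathcal{Q} = \{(x,t) \in \mathbb{R}^2\times\mathbb{R} : \|x\| \le t\} \subset \mathbb{R}^3$ is the three-dimensional second-order cone ($\|\cdot\|$ is the Euclidean norm), and $\mathcal{Q}^k\subset \mathbb{R}^{3k}$ is the Cartesian product of $k$ copies of $\mathcal{Q}$. A convex cone $T$ in a finite-dimensional real vector space $V$ is second-order cone representable (has a second-order cone lift) if, for some positive integer $k$, it has a $\mathcal{Q}^k$-lift, i.e. $T = \pi(\mathcal{Q}^k\cap L)$ for some linear map $\pi:\mathbb{R}^{3k}\to V$ and some linear subspace $L$ of $\mathbb{R}^{3k}$. Here $V$ is the space of real symmetric $3\times 3$ matrices. *)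

(* Defs.v *)
From HB Require Import structures.
From mathcomp Require Import all_boot all_order all_algebra.
From mathcomp Require Import classical_sets reals.

Set Implicit Arguments.
Unset Strict Implicit.
Unset Printing Implicit Defensive.

Import Order.TTheory GRing.Theory Num.Theory.

Local Open Scope classical_set_scope.
Local Open Scope ring_scope.

(* A bare predicate, on which the closure instance below can be keyed. *)
Definition symmetric_pred (R : realType) (n : nat) : pred 'M[R]_n :=
  fun A => A \is symmetricmx.

Fact symmetric_pred_submod_closed (R : realType) (n : nat) :
  submod_closed (@symmetric_pred R n).
Proof.
have symE (A : 'M[R]_n) : (A \in @symmetric_pred R n) = (A == A^T).
  by rewrite unfold_in sesquiE expr0 scale1r map_mx_id.
split=> [|a A B]; rewrite !symE ?trmx0 // => /eqP hA /eqP hB.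
by rewrite linearP /= -hA -hB.
Qed.

HB.instance Definition _ (R : realType) (n : nat) :=
  GRing.isSubmodClosed.Build R 'M[R]_n (@symmetric_pred R n)
    (@symmetric_pred_submod_closed R n).

(* The vector space of symmetric matrices, as a subtype of ['M[R]_n]. *)
Record symmx (R : realType) (n : nat) : Type :=
  SymMx { symmx_val :> 'M[R]_n; _ : symmetric_pred symmx_val }.

HB.instance Definition _ (R : realType) (n : nat) :=
  [isSub for @symmx_val R n].
HB.instance Definition _ (R : realType) (n : nat) :=
  [Choice of symmx R n by <:].
HB.instance Definition _ (R : realType) (n : nat) :=
  [SubChoice_isSubLmodule of symmx R n by <:].

Definition psd_cone (R : realType) (n : nat) : set (symmx R n) :=
  [set X | forall v : 'cV[R]_n, 0 <= (v^T *m X *m v) 0 0].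

(* [(x, t)] in R^2 x R is encoded as the row vector [x_0, x_1, t].  The
   Euclidean norm is spelled out because [`|x|] on matrices is the sup norm. *)
Definition soc (R : realType) : set 'rV[R]_3 :=
  [set v | Num.sqrt (v 0 0 ^+ 2 + v 0 1 ^+ 2) <= v 0 2].

(* R^(3k) is encoded as ['M[R]_(k, 3)], whose rows are the k blocks in R^3. *)
Definition soc_prod (R : realType) (k : nat) : set 'M[R]_(k, 3) :=
  [set x | forall i : 'I_k, soc (row i x)].

Definition soc_lift (R : realType) (V : lmodType R) (T : set V) (k : nat) :
    Prop :=
  exists (pi : {linear 'M[R]_(k, 3) -> V}) (L : {vspace 'M[R]_(k, 3)}),
    T = pi @` (@soc_prod R k `&` [set x | x \in L]).

(* Such a [T] is automatically a convex cone, so this is not required. *)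
Definition soc_representable (R : realType) (V : lmodType R) (T : set V) :
    Prop :=
  exists k : nat, (0 < k)%N /\ soc_lift T k.

Definition slice_cone (R : realType) : set (symmx R 3) :=
  [set X | psd_cone X /\ X 0 0 = X 1 1 + X 2 2].

(* Main.v *)
Require Import Defs.
From mathcomp Require Import all_boot all_order all_algebra.
From mathcomp Require Import ring lra.

(* The matrices v_t v_t^T with v_t = (1 + t^2, 1 - t^2, 2t) lie in the slice,
   and for p <> q the vector w orthogonal to v_p and v_q gives a functional
   X |-> w^T X w that is nonnegative on T, vanishes at t = p, q, and is positive
   at every other t.  Lift v_t v_t^T to a_t in Q^k /\ L for many values of t.
   By pigeonhole there are x, y, z among them such that in each of the k blocks
   the directions of a_x, a_y, a_z are either all equal or nonzero and pairwise
   distinct; in the second case the block of a_x + a_y is interior to Q.  In both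
   cases m (a_x + a_y) - a_z lies in Q^k /\ L for m large, while the functional
   attached to x, y is negative on its image.  Working with the lifted points
   rather than with a factorization of the slack matrix avoids conic duality and
   its regularity assumptions. *)

Set Implicit Arguments.
Unset Strict Implicit.
Unset Printing Implicit Defensive.

Import Order.TTheory GRing.Theory Num.Theory.

(** * Finite pigeonhole: subsets on which maps are constant or injective *)

Section Pigeonhole.

(** The fibres of [f] partition [A]. If there are more than [n] of them, a transversal serves;
    otherwise some fibre has more than [n] points, since at most [n] fibres of size at most [n]
    cannot fill [A]. *)
Lemma constant_or_injective_subset (T : finType) (K : eqType) (f : T -> K)
    (n : nat) (A : {set T}) :
  (n * n < #|A|)%N ->
  exists S : {set T}, [/\ S \subset A, (n < #|S|)%N &
    {in S &, forall x y, f x = f y} \/ {in S &, injective f}].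
Proof.
move=> ltA; set P := preim_partition f A.
have partP : partition P A := preim_partitionP f A.
have [ltP|leP] := ltnP n #|P|.
  exists (transversal P A); split.
  - exact: (transversal_sub (transversalP partP)).
  - by rewrite (card_transversal (transversalP partP)).
  right=> x y xX yX fxy; have tX := transversalP partP.
  have [xA yA] : x \in A /\ y \in A.
    by split; apply: (subsetP (transversal_sub tX)).
  apply: (pblock_inj tX) => //; apply/eqP.
  rewrite eq_pblock ?(cover_partition partP) //; last first.
    by case/and3P: partP.
  rewrite pblock_equivalence_partition //; first by apply/eqP.
  by split=> // /eqP ->.
have [/existsP[B /andP[PB ltB]]|noB] :=
  boolP [exists B : {set T}, (B \in P) && (n < #|B|)%N].
  exists B; split=> //.
    by rewrite -(cover_partition partP) (bigcup_max B).
  left=> x y xB yB.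
  have tP : trivIset P by case/and3P: partP.
  have BA : B \subset A by rewrite -(cover_partition partP) (bigcup_max B).
  apply/eqP; have : y \in pblock P x by rewrite (def_pblock tP PB xB).
  rewrite pblock_equivalence_partition ?(subsetP BA) //.
  by split=> // /eqP ->.
move: ltA; rewrite ltnNge (card_partition partP); case/negP.
apply: (@leq_trans (\sum_(B in P) n)%N).
  apply: leq_sum => B PB; rewrite leqNgt; apply: contra noB => ltB.
  by apply/existsP; exists B; rewrite PB.
by rewrite sum_nat_const leq_mul2r leP orbT.
Qed.

Lemma constant_or_injective_avoiding_subset (T : finType) (K : eqType) (z : K)
    (f : T -> K) (n : nat) (A : {set T}) :
  (n + n * n < #|A|)%N ->
  exists S : {set T}, [/\ S \subset A, (n < #|S|)%N &
    {in S &, forall x y, f x = f y} \/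
    {in S &, injective f} /\ {in S, forall x, f x != z}].
Proof.
move=> ltA; set Z := [set x | f x == z].
have [ltZ|leZ] := ltnP n #|A :&: Z|.
  exists (A :&: Z); split; rewrite ?subsetIl //; left=> x y.
  by rewrite !inE => /andP[_ /eqP ->] /andP[_ /eqP ->].
have ltD : (n * n < #|A :\: Z|)%N.
  rewrite -(ltn_add2l n); apply: (leq_trans ltA).
  by rewrite -(cardsID Z A) leq_add2r.
have [S [SD ltS cases]] := @constant_or_injective_subset _ _ f n _ ltD.
exists S; split=> //; first exact: subset_trans SD (subsetDl _ _).
case: cases => [|inj]; [by left | right; split=> // x xS].
by move/subsetP: SD => /(_ x xS); rewrite !inE => /andP[].
Qed.

(** One coordinate is treated at a time, each inside the subset found before, as both alternatives
    pass to subsets. [N] is fixed before [T] and [f], so it can dictate how many points to lift. *)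
Lemma simultaneous_constant_or_injective (K : eqType) (z : K) (k n : nat) :
  exists N : nat, forall (T : finType) (f : 'I_k -> T -> K) (A : {set T}),
  (N < #|A|)%N ->
  exists S : {set T}, [/\ S \subset A, (n < #|S|)%N & forall i,
    {in S &, forall x y, f i x = f i y} \/
    {in S &, injective (f i)} /\ {in S, forall x, f i x != z}].
Proof.
elim: k => [|k [N IH]].
  by exists n => T f A ltA; exists A; split=> // -[].
exists (N + N * N)%N => T f A ltA.
have [B [BA ltB f0]] :=
  @constant_or_injective_avoiding_subset _ _ z (f ord0) _ _ ltA.
have [S [SB ltS fS]] := IH T (fun i => f (lift ord0 i)) B ltB.
exists S; split=> //; first exact: subset_trans SB BA.
move=> i; case: (unliftP ord0 i) => [j ->|->]; first exact: fS.
move/subsetP in SB.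
case: f0 => [cst|[inj nz]]; [left|right; split].
- by move=> x y xS yS; apply: cst; apply: SB.
- by move=> x y xS yS; apply: inj; apply: SB.
- by move=> x xS; apply: nz; apply: SB.
Qed.

End Pigeonhole.

From mathcomp Require Import classical_sets reals.

Local Open Scope classical_set_scope.
Local Open Scope ring_scope.

(** * Geometry of the three-dimensional second-order cone *)

Section SecondOrderCone.
Variable R : realType.
Implicit Types a b c : 'rV[R]_3.

Lemma socP a :
  soc a <-> 0 <= a 0 2 /\ a 0 0 ^+ 2 + a 0 1 ^+ 2 <= a 0 2 ^+ 2.
Proof.
rewrite /soc /=; split=> [le_a|[a2 le_a]].
  have a2 := le_trans (sqrtr_ge0 _) le_a; split=> //.
  rewrite -[leLHS]sqr_sqrtr ?addr_ge0 ?sqr_ge0 //.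
  by rewrite lerXn2r ?nnegrE ?sqrtr_ge0.
by rewrite -[leRHS](ger0_norm a2) -sqrtr_sqr ler_wsqrtr.
Qed.

Lemma rV3P a b : a 0 0 = b 0 0 -> a 0 1 = b 0 1 -> a 0 2 = b 0 2 -> a = b.
Proof.
move=> e0 e1 e2; apply/rowP => -[[|[|[|//]]] lt_i].
- by have -> : Ordinal lt_i = 0 by apply: val_inj.
- by have -> : Ordinal lt_i = 1 by apply: val_inj.
- by have -> : Ordinal lt_i = 2 by apply: val_inj.
Qed.

Lemma socZ (m : R) a : 0 <= m -> soc a -> soc (m *: a).
Proof.
move=> m0 /socP[a2 le_a]; apply/socP; rewrite !mxE; split; first exact: mulr_ge0.
by rewrite !exprMn -mulrDr ler_wpM2l ?sqr_ge0.
Qed.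

Lemma soc_dot_le a b : soc a -> soc b ->
  a 0 0 * b 0 0 + a 0 1 * b 0 1 <= a 0 2 * b 0 2.
Proof.
move=> /socP[a2 le_a] /socP[b2 le_b].
set p := _ + _; have [p0|p0] := leP p 0; first by rewrite (le_trans p0) ?mulr_ge0.
rewrite -(@ler_pXn2r _ 2) ?nnegrE ?mulr_ge0 ?(ltW p0) // exprMn.
apply: (@le_trans _ _ ((a 0 0 ^+ 2 + a 0 1 ^+ 2) * (b 0 0 ^+ 2 + b 0 1 ^+ 2))).
  (* Cauchy-Schwarz in the plane, by Lagrange's identity. *)
  rewrite -subr_ge0.
  have -> : (a 0 0 ^+ 2 + a 0 1 ^+ 2) * (b 0 0 ^+ 2 + b 0 1 ^+ 2) - p ^+ 2
     = (a 0 0 * b 0 1 - a 0 1 * b 0 0) ^+ 2 by rewrite /p; ring.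
  exact: sqr_ge0.
by apply: ler_pM => //; rewrite addr_ge0 ?sqr_ge0.
Qed.

Lemma socD a b : soc a -> soc b -> soc (a + b).
Proof.
move=> sa sb; have := soc_dot_le sa sb.
move: sa sb => /socP[a2 le_a] /socP[b2 le_b] le_ab.
by apply/socP; rewrite !mxE; split; [lra | rewrite !sqrrD; lra].
Qed.

Lemma soc_eq0 a : soc a -> a 0 2 = 0 -> a = 0.
Proof.
move=> /socP[_ le_a] a2; move: le_a; rewrite a2 expr0n /= => le_a.
have /eqP : a 0 0 ^+ 2 + a 0 1 ^+ 2 = 0.
  by apply/eqP; rewrite eq_le le_a addr_ge0 ?sqr_ge0.
rewrite paddr_eq0 ?sqr_ge0 // !sqrf_eq0 => /andP[/eqP a0 /eqP a1].
by apply: rV3P; rewrite mxE.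
Qed.

(* The intersection of the ray of [a] with the plane [t = 1], and [0] when
   [a = 0], since [0^-1 = 0]. *)
Definition soc_dir a : 'rV[R]_3 := (a 0 2)^-1 *: a.

Lemma soc_dir_eq0 a : a 0 2 != 0 -> soc_dir a != 0.
Proof.
move=> a2; apply/eqP => /rowP/(_ 2); rewrite !mxE mulVf // => /eqP.
by rewrite oner_eq0.
Qed.

(** Here [c] is zero or a positive multiple of [a]. A threshold [m0], rather than a single [m], lets
    different blocks share one [m]. *)
Lemma soc_sub_same_dir a c : soc a -> soc c -> soc_dir a = soc_dir c ->
  exists2 m0 : R, 0 <= m0 & forall m, m0 <= m -> soc (m *: a - c).
Proof.
move=> sa sc dir; have [c2|c2] := eqVneq (c 0 2) 0.
  exists 0 => // m m0; rewrite (soc_eq0 sc c2) subr0; exact: socZ.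
have a2 : a 0 2 != 0.
  apply: contraNneq (soc_dir_eq0 c2) => a2.
  by rewrite -dir /soc_dir a2 invr0 scale0r.
have [[a2_ge0 _] [c2_ge0 _]] := ((socP a).1 sa, (socP c).1 sc).
exists (c 0 2 / a 0 2) => [|m le_m]; first exact: divr_ge0.
have -> : c = (c 0 2 / a 0 2) *: a.
  by rewrite -scalerA -/(soc_dir a) dir /soc_dir scalerA mulfV // scale1r.
by rewrite -scalerBl; apply: socZ; rewrite ?subr_ge0.
Qed.

Lemma soc_add_interior a b : soc a -> soc b ->
    soc_dir a != soc_dir b -> soc_dir a != 0 -> soc_dir b != 0 ->
  (a + b) 0 0 ^+ 2 + (a + b) 0 1 ^+ 2 < (a + b) 0 2 ^+ 2.
Proof.
move=> sa sb neq_dir nza nzb.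
have pos c : soc c -> soc_dir c != 0 -> 0 < c 0 2.
  move=> sc nzc; have [c2 _] := (socP c).1 sc; rewrite lt_def c2 andbT.
  by apply: contraNneq nzc => /(soc_eq0 sc) ->; rewrite /soc_dir scaler0.
have {nza} a2 := pos a sa nza; have {nzb} b2 := pos b sb nzb.
move: sa sb => /socP[_ le_a] /socP[_ le_b].
(* [u] and [v] are the coordinates of [soc_dir a - soc_dir b] scaled by [a 0 2 * b 0 2]; their not
   both vanishing makes Cauchy-Schwarz strict. *)
set u := b 0 2 * a 0 0 - a 0 2 * b 0 0.
set v := b 0 2 * a 0 1 - a 0 2 * b 0 1.
have uv : 0 < u ^+ 2 + v ^+ 2.
  rewrite lt_def addr_ge0 ?sqr_ge0 // andbT.
  rewrite paddr_eq0 ?sqr_ge0 // !sqrf_eq0 !subr_eq0.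
  apply: contra neq_dir => /andP[/eqP e0 /eqP e1]; apply/eqP.
  have a2n := lt0r_neq0 a2; have b2n := lt0r_neq0 b2.
  apply: rV3P; rewrite !mxE ?mulVf // ![_^-1 * _]mulrC.
  - by apply/eqP; rewrite eqr_div // mulrC e0 mulrC.
  - by apply/eqP; rewrite eqr_div // mulrC e1 mulrC.
set p := a 0 0 * b 0 0 + a 0 1 * b 0 1.
have lt_p : p < a 0 2 * b 0 2.
  have ab2 := mulr_gt0 a2 b2.
  rewrite -subr_gt0 -(pmulr_rgt0 _ ab2) -(pmulr_rgt0 _ (ltr0n R 2)).
  apply: (lt_le_trans uv).
  have -> : u ^+ 2 + v ^+ 2 = b 0 2 ^+ 2 * (a 0 0 ^+ 2 + a 0 1 ^+ 2)
     + a 0 2 ^+ 2 * (b 0 0 ^+ 2 + b 0 1 ^+ 2) - 2 * (a 0 2 * b 0 2 * p).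
    by rewrite /u /v /p; ring.
  have := ler_wpM2l (sqr_ge0 (b 0 2)) le_a.
  have := ler_wpM2l (sqr_ge0 (a 0 2)) le_b.
  have -> : 2 * (a 0 2 * b 0 2 * (a 0 2 * b 0 2 - p)) =
     b 0 2 ^+ 2 * a 0 2 ^+ 2 + a 0 2 ^+ 2 * b 0 2 ^+ 2
     - 2 * (a 0 2 * b 0 2 * p) by ring.
  by lra.
by move: lt_p; rewrite /p !mxE !sqrrD; lra.
Qed.

(** With the Lorentz form q(v) = v_2^2 - v_0^2 - v_1^2, q(m a - c) is quadratic in m with leading
    coefficient q(a) > 0. *)
Lemma soc_sub_interior a c : soc a -> soc c ->
    a 0 0 ^+ 2 + a 0 1 ^+ 2 < a 0 2 ^+ 2 ->
  exists2 m0 : R, 0 <= m0 & forall m, m0 <= m -> soc (m *: a - c).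
Proof.
move=> sa sc lt_a; have le_p := soc_dot_le sa sc.
move: sa sc => /socP[a2_ge0 _] /socP[c2 le_c].
have a2 : 0 < a 0 2.
  rewrite lt_def a2_ge0 andbT; apply: contraTneq lt_a => ->.
  by rewrite expr0n /= -leNgt addr_ge0 ?sqr_ge0.
set d := a 0 2 ^+ 2 - (a 0 0 ^+ 2 + a 0 1 ^+ 2).
have d0 : 0 < d by rewrite subr_gt0.
set p := a 0 2 * c 0 2 - (a 0 0 * c 0 0 + a 0 1 * c 0 1).
have p0 : 0 <= p by rewrite subr_ge0.
have ge1 : 0 <= 2 * p / d by rewrite divr_ge0 ?mulr_ge0 // ltW.
have ge2 : 0 <= c 0 2 / a 0 2 by rewrite divr_ge0 // ltW.
(* The first summand controls the Lorentz form, the second the sign of the last coordinate. *)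
exists (2 * p / d + c 0 2 / a 0 2) => [|m le_m]; first exact: addr_ge0.
have m1 : 2 * p <= m * d by rewrite -ler_pdivrMr //; lra.
have m2 : c 0 2 <= m * a 0 2 by rewrite -ler_pdivrMr //; lra.
have m0 : 0 <= m by lra.
apply/socP; rewrite !mxE; split; first by rewrite subr_ge0.
rewrite -subr_ge0.
have -> : (m * a 0 2 - c 0 2) ^+ 2
   - ((m * a 0 0 - c 0 0) ^+ 2 + (m * a 0 1 - c 0 1) ^+ 2)
  = m * (m * d - 2 * p) + (c 0 2 ^+ 2 - (c 0 0 ^+ 2 + c 0 1 ^+ 2)).
  by rewrite /d /p; ring.
by rewrite addr_ge0 ?mulr_ge0 ?subr_ge0.
Qed.

Lemma soc_prod_sub (k : nat) (a b c : 'M[R]_(k, 3)) :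
    soc_prod a -> soc_prod b -> soc_prod c ->
    (forall i, exists2 m0 : R, 0 <= m0 &
       forall m, m0 <= m -> soc (m *: (row i a + row i b) - row i c)) ->
  exists m : R, soc_prod (m *: (a + b) - c).
Proof.
move=> sa sb sc /fin_all_exists2[m0 m0_ge0 m0P].
(* The thresholds are nonnegative, so their sum dominates each of them. *)
exists (\sum_i m0 i) => i; rewrite linearB linearZ /= linearD /=.
by apply: m0P; rewrite (bigD1 i) //= lerDl sumr_ge0.
Qed.

End SecondOrderCone.

(** * A curve of rank-one matrices in the slice *)

Section Slice.
Variable R : realType.

Definition slice_vec (t : R) : 'cV[R]_3 :=
  \col_i tnth [tuple 1 + t ^+ 2; 1 - t ^+ 2; 2 * t] i.

(* Orthogonal to [slice_vec p] and [slice_vec q]: the coefficients of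
   [2 (t - p) (t - q)] in terms of [1 + t^2], [1 - t^2] and [2 t]. *)
Definition slice_normal (p q : R) : 'cV[R]_3 :=
  \col_i tnth [tuple 1 + p * q; p * q - 1; - (p + q)] i.

Lemma slice_normalE (p q t : R) :
  ((slice_normal p q)^T *m slice_vec t) 0 0 = 2 * ((t - p) * (t - q)).
Proof. by rewrite !mxE !big_ord_recl big_ord0 !mxE /tnth /=; ring. Qed.

Fact outer_symmetric (v : 'cV[R]_3) : symmetric_pred (v *m v^T).
Proof.
by rewrite /symmetric_pred sesquiE expr0 scale1r map_mx_id // trmx_mul trmxK.
Qed.

Definition outer (v : 'cV[R]_3) : symmx R 3 := SymMx (outer_symmetric v).

Lemma outer_form (v w : 'cV[R]_3) :
  (w^T *m outer v *m w) 0 0 = ((w^T *m v) 0 0) ^+ 2.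
Proof.
rewrite /= mulmxA -mulmxA mxE big_ord1 expr2; congr (_ * _).
by rewrite -[v^T *m w]trmxK trmx_mul trmxK mxE.
Qed.

(** The linear equation of the slice becomes (1 + t^2)^2 = (1 - t^2)^2 + (2t)^2. *)
Lemma slice_cone_outer (t : R) : slice_cone (outer (slice_vec t)).
Proof.
split=> [w|]; first by rewrite outer_form sqr_ge0.
by rewrite /= !mxE !big_ord1 !mxE /tnth /=; ring.
Qed.

End Slice.

(** * Contradiction from a lift *)

Lemma slice_cone_not_sandwiched (R : realType) (T : set (symmx R 3)) :
  soc_representable T -> @slice_cone R `<=` T -> T `<=` @psd_cone R 3 -> False.
Proof.
move=> [k [_ [pi [L ->]]]] CT Tpsd.
(* The avoided value 0 is the direction of a zero block; 2 yields three points. *)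
have [N NP] := @simultaneous_constant_or_injective 'rV[R]_3 0 k 2.
have /fin_all_exists2[a aQL pia] (j : 'I_N.+1) :
    exists2 x : 'M[R]_(k, 3), (@soc_prod R k `&` [set x | x \in L]) x &
      pi x = outer (slice_vec j%:R).
  by have [x] := CT _ (slice_cone_outer (R := R) j%:R); exists x.
have aQ j : soc_prod (a j) by case: (aQL j).
have rowQ i j : soc (row i (a j)) by apply: aQ.
have aL j : a j \in L by case: (aQL j).
have [|S [_ ltS aS]] :=
  NP 'I_N.+1 (fun i j => soc_dir (row i (a j))) [set: 'I_N.+1]%SET.
  by rewrite cardsT card_ord.
have [x [y [z [[xS yS zS] [xy yz zx]]]]] := card_gt2P ltS.
have [m mQ] : exists m : R, soc_prod (m *: (a x + a y) - a z).
  apply: soc_prod_sub => // i; case: (aS i) => [cst|[inj nz]].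
    have [m0 m0_ge0 m0P] := soc_sub_same_dir (rowQ i x) (rowQ i z) (cst x z xS zS).
    exists m0 => // m le_m; rewrite scalerDr addrAC; apply: socD; first exact: m0P.
    exact: socZ (le_trans m0_ge0 le_m) (rowQ i y).
  apply: soc_sub_interior => //; first exact: (socD (rowQ i x) (rowQ i y)).
  apply: soc_add_interior => //; [|exact: nz|exact: nz].
  by apply: contra xy => /eqP /inj ->.
set w := slice_normal (R := R) x%:R y%:R.
have /Tpsd /(_ w) : (pi @` (@soc_prod R k `&` [set x | x \in L]))
    (pi (m *: (a x + a y) - a z)).
  exists (m *: (a x + a y) - a z) => //; split=> //=.
  by rewrite memvB ?memvZ ?memvD.
have -> : symmx_val (pi (m *: (a x + a y) - a z)) =
    m *: (symmx_val (outer (slice_vec x%:R))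
          + symmx_val (outer (slice_vec y%:R)))
    - symmx_val (outer (slice_vec z%:R)).
  by rewrite linearB linearZ linearD /= !pia.
rewrite mulmxBr mulmxBl -scalemxAr -scalemxAl mulmxDr mulmxDl.
rewrite 2![in X in 0 <= X]mxE [in X in _ + X]mxE [in X in _ * X + _]mxE.
(* The terms of [x] and [y] vanish, leaving minus the square of 2(z - x)(z - y), which is nonzero
   for distinct indices. *)
rewrite !outer_form !slice_normalE !subrr mul0r !mulr0 expr0n /= addr0 mulr0.
rewrite add0r oppr_ge0 leNgt lt_def sqr_ge0 andbT sqrf_eq0.
rewrite !mulf_eq0 pnatr_eq0 !subr_eq0 !eqr_nat /=.
by rewrite !(inj_eq val_inj) (negPf zx) eq_sym (negPf yz).
Qed.

Theorem mainTheorem2 (R : realType) :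
  ~ (exists T : set (symmx R 3),
       soc_representable T /\
       @slice_cone R `<=` T /\ T `<=` @psd_cone R 3) /\
  ~ soc_representable (@slice_cone R).
Proof.
split=> [[T [socT [CT Tpsd]]]|socC].
  exact: slice_cone_not_sandwiched socT CT Tpsd.
by apply: slice_cone_not_sandwiched socC _ _ => // X [].
Qed.
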